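(* Let $B_1,B_2$ be skew left braces, let $\alpha:(B_2,\circ)\to \mathrm{Aut}(B_1,+,\circ)$ be a group homomorphism, and let $B:=B_1\rtimes_{\alpha} B_2$ be the semidirect product of skew left braces via $\alpha$. Suppose that $B_1$ is Artinian. If $B$ is semiprime, then $B_1$ is semiprime.
   Context: A skew left brace is a triple $(B,+,\circ)$ such that $(B,+)$ and $(B,\circ)$ are (not necessarily abelian) groups and $a\circ(b+c)=a\circ b-a+a\circ c$ for all $a,b,c\in B$. The two groups share the same identity, denoted $0$. For $a\in B$ put $\lambda_a(b):=-a+a\circ b$. An ideal of $B$ is a subset $I\subseteq B$ that is a normal subgroup of $(B,+)$, a normal subgroup of $(B,\circ)$, and satisfies $\lambda_a(I)\subseteq I$ for all $a\in B$. $B$ is Artinian if every descending chain of ideals of $B$ is eventually stationary. $\mathrm{Aut}(B,+,\circ)$ is the group of bijections of $B$ preserving both operations. Put $a*b:=-a+a\circ b-b$; for $X,Y\subseteq B$, $X*Y$ denotes the additive subgroup generated by all $x*y$ with $x\in X$, $y\in Y$. $B$ is semiprime if $I*I\neq\{0\}$ for each non-zero ideal $I$ of $B$. The semidirect product $B_1\rtimes_\alpha B_2$ is the set $B_1\times B_2$ with operations $(a_1,a_2)+(b_1,b_2)=(a_1+b_1,a_2+b_2)$ and $(a_1,a_2)\circ(b_1,b_2)=(a_1\circ\alpha_{a_2}(b_1),a_2\circ b_2)$; it is a skew left brace. *)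

(* Defs.v *)
(* The circle group of a skew left brace is its [groupType] structure; the
   additive group is carried by [isSkewBrace], since [zmodType] would force
   commutativity.  The choice structure that [groupType] requires exists on
   every type ([gen_eqMixin], [gen_choiceMixin]). *)
From HB Require Import structures.
From mathcomp Require Import all_boot.
From mathcomp Require Import boolp classical_sets.

Set Implicit Arguments.
Unset Strict Implicit.
Unset Printing Implicit Defensive.

Declare Scope brace_scope.
Delimit Scope brace_scope with B.
Local Open Scope classical_set_scope.
Local Open Scope brace_scope.

Notation "x <o> y" := (mul x y)
  (at level 40, left associativity) : brace_scope.

HB.mixin Record isSkewBrace B of Group B := {
  badd : B -> B -> B;
  bzero : B;
  bopp : B -> B;
  baddA : associative badd;
  badd0l : left_id bzero badd;
  badd0r : right_id bzero badd;
  baddNl : left_inverse bzero bopp badd;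
  baddNr : right_inverse bzero bopp badd;
  braceD : forall a b c : B,
    a <o> badd b c = badd (badd (a <o> b) (bopp a)) (a <o> c)
}.

#[short(type="skewBraceType")]
HB.structure Definition SkewBrace := {B of isSkewBrace B & Group B}.

Notation "0" := (@bzero _) : brace_scope.
Notation "- x" := (bopp x) : brace_scope.
Notation "x + y" := (badd x y) : brace_scope.
Notation "x - y" := (badd x (bopp y)) : brace_scope.

Lemma brace_one0 (B : skewBraceType) : (1%g : B) = 0.
Proof.
have h (a : B) : a <o> 0 = a.
  have := braceD a 0 0; rewrite badd0l => /(congr1 (fun x => - (a <o> 0) + x)).
  rewrite -!baddA !baddA baddNl !badd0l => /(congr1 (fun x => a + x)).
  by rewrite badd0r !baddA baddNr badd0l.
by rewrite -(mul1g 0%B) h.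
Qed.

Section Ideals.
Variable B : skewBraceType.
Implicit Types (a b : B) (I S X Y : set B).

Definition lambda a b : B := - a + a <o> b.

Definition star a b : B := - a + a <o> b - b.

Record add_subgroup S : Prop := AddSubgroup {
  add_subgroup0 : S 0;
  add_subgroupD : forall a b, S a -> S b -> S (a + b);
  add_subgroupN : forall a, S a -> S (- a)
}.

Record circ_subgroup S : Prop := CircSubgroup {
  circ_subgroup1 : S 1%g;
  circ_subgroupM : forall a b, S a -> S b -> S (a <o> b);
  circ_subgroupV : forall a, S a -> S a^-1%g
}.

Record ideal I : Prop := Ideal {
  ideal_add : add_subgroup I;
  ideal_add_normal : forall a x, I x -> I (a + x - a);
  ideal_circ : circ_subgroup I;
  ideal_circ_normal : forall a x, I x -> I (a <o> x <o> a^-1%g);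
  ideal_lambda : forall a, lambda a @` I `<=` I
}.

Definition star_set X Y : set B :=
  smallest add_subgroup [set star x y | x in X & y in Y].

End Ideals.

Definition artinian (B : skewBraceType) : Prop :=
  forall I : nat -> set B,
    (forall n, ideal (I n)) -> (forall n, I n.+1 `<=` I n) ->
    exists N, forall n, N <= n -> I n = I N.

Definition semiprime (B : skewBraceType) : Prop :=
  forall I : set B, ideal I -> I <> [set 0] -> star_set I I <> [set 0].

(* The inverse map is stored as data; it is determined by [aut_fun], see
   [brace_aut_eq]. *)
Record brace_aut (B : skewBraceType) : Type := BraceAut {
  aut_fun :> B -> B;
  aut_inv : B -> B;
  aut_funK : cancel aut_fun aut_inv;
  aut_invK : cancel aut_inv aut_fun;
  autD : forall a b, aut_fun (a + b) = aut_fun a + aut_fun b;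
  autM : forall a b, aut_fun (a <o> b) = aut_fun a <o> aut_fun b
}.

HB.instance Definition _ (B : skewBraceType) := gen_eqMixin (brace_aut B).
HB.instance Definition _ (B : skewBraceType) := gen_choiceMixin (brace_aut B).

Section Automorphisms.
Variable B : skewBraceType.
Implicit Types f g : brace_aut B.

Lemma brace_aut_eq f g : aut_fun f =1 aut_fun g -> f = g.
Proof.
move=> /funext; case: f g => [f f' fK f'K fD fM] [g g' gK g'K gD gM] /= efg.
rewrite -{}efg in gK g'K gD gM *.
have e : f' = g' by apply/funext => x; rewrite -{1}(g'K x) fK.
rewrite -{}e in gK g'K *.
by congr BraceAut; exact: Prop_irrelevance.
Qed.

Lemma autVD f a b : aut_inv f (a + b) = aut_inv f a + aut_inv f b.
Proof. by rewrite -{1}(aut_invK f a) -{1}(aut_invK f b) -autD aut_funK. Qed.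

Lemma autVM f a b : aut_inv f (a <o> b) = aut_inv f a <o> aut_inv f b.
Proof. by rewrite -{1}(aut_invK f a) -{1}(aut_invK f b) -autM aut_funK. Qed.

Definition brace_aut_one : brace_aut B :=
  @BraceAut B id id (fun=> erefl) (fun=> erefl)
    (fun _ _ => erefl) (fun _ _ => erefl).

Definition brace_aut_inv f : brace_aut B :=
  BraceAut (aut_invK f) (aut_funK f) (autVD f) (autVM f).

Lemma autMD f g a b : (f \o g) (a + b) = (f \o g) a + (f \o g) b.
Proof. by rewrite /= !autD. Qed.

Lemma autMM f g a b : (f \o g) (a <o> b) = (f \o g) a <o> (f \o g) b.
Proof. by rewrite /= !autM. Qed.

Definition brace_aut_mul f g : brace_aut B :=
  BraceAut (can_comp (aut_funK f) (aut_funK g))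
    (can_comp (aut_invK g) (aut_invK f)) (autMD f g) (autMM f g).

Fact brace_aut_mulA : associative brace_aut_mul.
Proof. by move=> f g h; exact: brace_aut_eq. Qed.

Fact brace_aut_mul1 : left_id brace_aut_one brace_aut_mul.
Proof. by move=> f; exact: brace_aut_eq. Qed.

Fact brace_aut_mulr1 : right_id brace_aut_one brace_aut_mul.
Proof. by move=> f; exact: brace_aut_eq. Qed.

Fact brace_aut_mulV : left_inverse brace_aut_one brace_aut_inv brace_aut_mul.
Proof. by move=> f; apply: brace_aut_eq => x /=; rewrite aut_funK. Qed.

Fact brace_aut_mulrV : right_inverse brace_aut_one brace_aut_inv brace_aut_mul.
Proof. by move=> f; apply: brace_aut_eq => x /=; rewrite aut_invK. Qed.

HB.instance Definition _ := isGroup.Build (brace_aut B)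
  brace_aut_mulA brace_aut_mul1 brace_aut_mulr1 brace_aut_mulV brace_aut_mulrV.

End Automorphisms.

(* An alias of the product type, so that the componentwise circle operation
   (the library's group structure on pairs) is not inferred for it. *)
Definition semidirect (B1 B2 : skewBraceType)
  (alpha : {multiplicative B2 -> brace_aut B1}) : Type := (B1 * B2)%type.

Section SemiDirect.
Variables (B1 B2 : skewBraceType) (alpha : {multiplicative B2 -> brace_aut B1}).
Let T := semidirect alpha.
Implicit Types u v w : T.

HB.instance Definition _ := Choice.copy T (B1 * B2)%type.

Definition sd_zero : T := (0, 0).
Definition sd_opp u : T := (- u.1, - u.2).
Definition sd_add u v : T := (u.1 + v.1, u.2 + v.2).

Definition sd_one : T := (1%g, 1%g).
Definition sd_mul u v : T := (u.1 <o> alpha u.2 v.1, u.2 <o> v.2).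
Definition sd_inv u : T := (alpha u.2^-1%g u.1^-1%g, u.2^-1%g).

Lemma alpha1 x : alpha 1%g x = x.
Proof.
apply: (can_inj (aut_funK (alpha 1%g))).
by rewrite -[LHS]/((alpha 1%g * alpha 1%g)%g x) -gmulfM mulg1.
Qed.

Lemma alphaM a b x : alpha (a <o> b) x = alpha a (alpha b x).
Proof. by rewrite gmulfM. Qed.

Lemma aut1 (f : brace_aut B1) : f 1%g = 1%g.
Proof. by apply: (mulgI (f 1%g)); rewrite -autM !mulg1. Qed.

Fact sd_mulA : associative sd_mul.
Proof. by move=> u v w; rewrite /sd_mul /= autM alphaM !mulgA. Qed.

Fact sd_mul1g : left_id sd_one sd_mul.
Proof. by move=> [a b]; rewrite /sd_mul /= alpha1 !mul1g. Qed.

Fact sd_mulg1 : right_id sd_one sd_mul.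
Proof. by move=> [a b]; rewrite /sd_mul /= aut1 !mulg1. Qed.

Fact sd_mulVg : left_inverse sd_one sd_inv sd_mul.
Proof. by move=> [a b]; rewrite /sd_mul /= -autM !mulVg aut1. Qed.

Fact sd_mulgV : right_inverse sd_one sd_inv sd_mul.
Proof. by move=> [a b]; rewrite /sd_mul /= -alphaM !mulgV alpha1 mulgV. Qed.

HB.instance Definition _ :=
  isGroup.Build T sd_mulA sd_mul1g sd_mulg1 sd_mulVg sd_mulgV.

Fact sd_addA : associative sd_add.
Proof. by move=> u v w; congr pair; exact: baddA. Qed.

Fact sd_add0l : left_id sd_zero sd_add.
Proof. by case=> a b; congr pair; exact: badd0l. Qed.

Fact sd_add0r : right_id sd_zero sd_add.
Proof. by case=> a b; congr pair; exact: badd0r. Qed.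

Fact sd_addNl : left_inverse sd_zero sd_opp sd_add.
Proof. by move=> u; congr pair; exact: baddNl. Qed.

Fact sd_addNr : right_inverse sd_zero sd_opp sd_add.
Proof. by move=> u; congr pair; exact: baddNr. Qed.

Fact sd_braceD u v w :
  u <o> sd_add v w = sd_add (sd_add (u <o> v) (sd_opp u)) (u <o> w).
Proof. by congr pair; rewrite /= ?autD; exact: braceD. Qed.

HB.instance Definition _ := isSkewBrace.Build T
  sd_addA sd_add0l sd_add0r sd_addNl sd_addNr sd_braceD.

End SemiDirect.

(* Main.v *)
(* By the Artinian hypothesis, a non-zero ideal I of B1 with I * I = 0 contains
   a minimal ideal M, and M * M = 0.  The translates of M under alpha are again
   minimal, so two distinct ones meet trivially and therefore star each other to
   0.  Hence their additive span S is an ideal on which + and the circle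
   operation agree.  As S is alpha-invariant, S x {0} is a non-zero ideal of the
   semidirect product with zero square. *)
Require Import Defs.
From HB Require Import structures.
From mathcomp Require Import all_boot.
From mathcomp Require Import boolp classical_sets.

Set Implicit Arguments.
Unset Strict Implicit.
Unset Printing Implicit Defensive.

Local Open Scope classical_set_scope.
Local Open Scope brace_scope.

(** * Additive cancellation, the action [lambda] and its relation to [star] *)

Section BraceTheory.
Variable B : skewBraceType.
Implicit Types (a b c x y z : B) (I J : set B).

Lemma baddKl a : cancel (badd a) (badd (- a)).
Proof. by move=> x; rewrite baddA baddNl badd0l. Qed.

Lemma baddNKl a : cancel (badd (- a)) (badd a).
Proof. by move=> x; rewrite baddA baddNr badd0l. Qed.

Lemma baddKr a x : x + a - a = x.
Proof. by rewrite -baddA baddNr badd0r. Qed.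

Lemma baddNKr a x : x - a + a = x.
Proof. by rewrite -baddA baddNl badd0r. Qed.

Lemma bsub_eq0 x y : x - y = 0 -> x = y.
Proof. by move=> e; rewrite -(baddNKr y x) e badd0l. Qed.

Lemma bopp_uniq x y : x + y = 0 -> y = - x.
Proof. by move=> e; rewrite -(baddKl x y) e badd0r. Qed.

Lemma bopp0 : - (0 : B) = 0.
Proof. by rewrite -[LHS]badd0l baddNr. Qed.

Lemma circE a b : a <o> b = a + lambda a b.
Proof. by rewrite /lambda baddNKl. Qed.

Lemma lambdaD a b c : lambda a (b + c) = lambda a b + lambda a c.
Proof. by rewrite /lambda braceD !baddA. Qed.

Lemma lambda0 a : lambda a 0 = 0.
Proof. by rewrite /lambda -brace_one0 mulg1 brace_one0 baddNl. Qed.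

Lemma lambdaN a b : lambda a (- b) = - lambda a b.
Proof. by apply: bopp_uniq; rewrite -lambdaD baddNr lambda0. Qed.

Lemma lambda1 x : lambda 1%g x = x.
Proof. by rewrite /lambda mul1g brace_one0 bopp0 badd0l. Qed.

(** Adding [a <o> b] on the left turns both sides into [a <o> b <o> x], by associativity of the
    circle operation. *)
Lemma lambdaM a b x : lambda (a <o> b) x = lambda a (lambda b x).
Proof.
apply: (can_inj (baddKl (a <o> b))).
by rewrite -circE {2}[a <o> b]circE -baddA -lambdaD -circE -circE mulgA.
Qed.

Lemma boppE x : - x = lambda x x^-1%g.
Proof. by rewrite /lambda mulgV brace_one0 badd0r. Qed.

Lemma invgE x : x^-1%g = lambda x^-1%g (- x).
Proof. by rewrite boppE -lambdaM mulVg lambda1. Qed.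

Lemma star_eq0 a b : star a b = 0 <-> lambda a b = b.
Proof.
split; first exact: bsub_eq0.
by rewrite /star -/(lambda a b) => ->; rewrite baddNr.
Qed.

Lemma star_set_eq0P I : I 0 ->
  star_set I I = [set 0] <-> (forall x y, I x -> I y -> star x y = 0).
Proof.
move=> I0; split=> [e x y Ix Iy|h].
  suff : star_set I I (star x y) by rewrite e.
  by apply: sub_gen_smallest; exists x => //; exists y.
apply/seteqP; split=> [z|_ ->]; last by move=> A [[]].
apply; split; last by move=> _ [x Ix [y Iy <-]]; exact: h.
by split=> [//|a b -> ->|a ->] /=; rewrite ?badd0l ?bopp0.
Qed.

(** * Ideals and their behaviour under automorphisms *)

Lemma ideal0 I : ideal I -> I 0.
Proof. by case=> -[]. Qed.

Lemma ideal_neq0 I : ideal I -> I <> [set 0] -> exists2 x, I x & x <> 0.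
Proof.
move=> idI nI; apply: contrapT => h; apply: nI; apply/seteqP; split=> [x Ix|_ ->].
  by apply: contrapT => nx; apply: h; exists x.
exact: ideal0.
Qed.

Lemma ideal_star_r I x y : ideal I -> I y -> I (star x y).
Proof.
move=> idI Iy; have [_ D N] := ideal_add idI.
by apply: D (N _ Iy); apply: (ideal_lambda idI (a := x)); exists y.
Qed.

Lemma ideal_star_l I x y : ideal I -> I x -> I (star x y).
Proof.
move=> idI Ix; have [_ D N] := ideal_add idI.
(* With x' the circle conjugate of x by [y^-1], [star x y] becomes [- x + (y + lambda y x' - y)],
   and both summands lie in I. *)
rewrite /star; have -> : x <o> y = y <o> (y^-1%g <o> x <o> y^-1%g^-1%g).
  by rewrite !invgK !mulgA mulgV mul1g.
rewrite circE -[_ + _ - _]baddA; apply: D; first exact: N.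
apply: (ideal_add_normal idI); apply: (ideal_lambda idI (a := y)).
by eexists; [exact: (ideal_circ_normal idI y^-1%g Ix)|].
Qed.

Lemma idealI I J : ideal I -> ideal J -> ideal (I `&` J).
Proof.
move=> [[I0 ID IN] In [I1 IM IV] Ic Il] [[J0 JD JN] Jn [J1 JM JV] Jc Jl].
split.
- by split=> // [a b [? ?] [? ?]|a [? ?]]; split; auto.
- by move=> a x [? ?]; split; auto.
- by split=> // [a b [? ?] [? ?]|a [? ?]]; split; auto.
- by move=> a x [? ?]; split; auto.
- by move=> a _ [x [Ix Jx] <-]; split; [apply: (Il a)|apply: (Jl a)]; exists x.
Qed.

Lemma brace_aut0 (f : brace_aut B) : f 0 = 0.
Proof. by rewrite -!brace_one0 aut1. Qed.

Lemma brace_autN (f : brace_aut B) x : f (- x) = - f x.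
Proof. by apply: bopp_uniq; rewrite -autD baddNr brace_aut0. Qed.

Lemma brace_autV (f : brace_aut B) x : f x^-1%g = (f x)^-1%g.
Proof. by apply: (mulgI (f x)); rewrite -autM !mulgV aut1. Qed.

Lemma brace_aut_lambda (f : brace_aut B) a x :
  f (lambda a x) = lambda (f a) (f x).
Proof. by rewrite /lambda autD brace_autN autM. Qed.

Lemma ideal_preimage (f : brace_aut B) I : ideal I -> ideal (f @^-1` I).
Proof.
move=> [[I0 ID IN] In [I1 IM IV] Ic Il]; split.
- split=> [|a b|a]; rewrite /preimage /= ?brace_aut0 ?autD ?brace_autN //.
  - exact: ID.
  - exact: IN.
- by move=> a x; rewrite /preimage /= !autD brace_autN; exact: In.
- split=> [|a b|a]; rewrite /preimage /= ?aut1 ?autM ?brace_autV //.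
  - exact: IM.
  - exact: IV.
- by move=> a x; rewrite /preimage /= !autM brace_autV; exact: Ic.
- by move=> a _ [x Ix <-]; rewrite /preimage /= brace_aut_lambda; apply: Il;
    exists (f x).
Qed.

(** * Minimal ideals and their translates *)

Definition minimal_ideal I :=
  [/\ ideal I, I <> [set 0] &
      forall J, ideal J -> J `<=` I -> J <> [set 0] -> J = I].

(** Otherwise every non-zero ideal inside I strictly contains another one; iterating a choice
    function from I gives a chain that never becomes stationary. *)
Lemma artinian_minimal_ideal I : artinian B -> ideal I -> I <> [set 0] ->
  exists2 M, minimal_ideal M & M `<=` I.
Proof.
move=> art idI nI; apply: contrapT => noM.
pose P J := [/\ ideal J, J `<=` I & J <> [set 0]].
have step (J : {J | P J}) : exists K : {J | P J}, sval K `<=` sval J /\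
    sval K <> sval J.
  case: J => J [idJ JI nJ] /=; apply: contrapT => h.
  apply: noM; exists J => //; split=> // K idK KJ nK.
  apply: contrapT => nKJ; apply: h.
  by have PK : P K by [split=> //; exact: subset_trans JI]; exists (exist _ K PK).
have [next nextP] := choice step.
pose chain n := iter n next (exist _ I (And3 idI (@subset_refl _ I) nI)).
have [||N eN] := art (fun n => sval (chain n)).
- by move=> n; case: (svalP (chain n)).
- by move=> n; case: (nextP (chain n)).
by case: (nextP (chain N)) => _; apply; exact: (eN N.+1).
Qed.

Lemma minimal_preimage_sub (f g : brace_aut B) M x : minimal_ideal M ->
  M (f x) -> M (g x) -> x <> 0 -> f @^-1` M `<=` g @^-1` M.
Proof.
move=> [idM _ minM] Mf Mg nx y My.
(* J is the image under f of the intersection of the two translates: an ideal inside M, non-zero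
   because it contains [f x]. Minimality forces J to be M. *)
pose J : set B := brace_aut_inv f @^-1` (f @^-1` M `&` g @^-1` M).
suff eJ : J = M.
  by move: My; rewrite /preimage /= -{1}eJ => -[_]; rewrite /= aut_funK.
apply: minM.
- by apply: ideal_preimage; apply: idealI; exact: ideal_preimage.
- by move=> z [] /=; rewrite aut_invK.
- move=> eJ; apply: nx; apply: (can_inj (aut_funK f)); rewrite brace_aut0.
  have : J (f x) by rewrite /J /preimage /= aut_funK.
  by rewrite eJ.
Qed.

(** [star x y] lies in both translates. If it is non-zero, then y lies in the translate of x as
    well, and applying f reduces the claim to [M * M = 0]. *)
Lemma minimal_preimage_star0 (f g : brace_aut B) M x y : minimal_ideal M ->
  (forall x y, M x -> M y -> star x y = 0) ->
  M (f x) -> M (g y) -> lambda x y = y.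
Proof.
move=> minM M0 Mx My; have [idM _ _] := minM.
apply/star_eq0; apply: contrapT => nxy; apply: (nxy); apply/star_eq0.
have : (f @^-1` M) y.
  apply: (minimal_preimage_sub (f := g) minM _ _ nxy) => //.
  - exact: (ideal_star_r _ (ideal_preimage g idM)).
  - exact: (ideal_star_l _ (ideal_preimage f idM)).
move=> Mfy; apply: (can_inj (aut_funK f)).
by rewrite brace_aut_lambda; apply/star_eq0; exact: M0.
Qed.

(** * The additive span of a stable set whose elements act trivially on it *)

Section TrivialSpan.
Variable U : set B.
Hypothesis UU : forall x y, U x -> U y -> lambda x y = y.
Hypothesis UaddJ : forall a x, U x -> U (a + x - a).
Hypothesis UcircJ : forall a x, U x -> U (a <o> x <o> a^-1%g).
Hypothesis Ulambda : forall a x, U x -> U (lambda a x).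

Let S := smallest (@add_subgroup B) U.

Lemma span_subgroup : add_subgroup S.
Proof.
split=> [A [[]] //|a b Sa Sb A hA|a Sa A hA]; case: (hA) => -[_ D N] _.
- by apply: D; [exact: Sa|exact: Sb].
- by apply: N; exact: Sa.
Qed.

(** The elements of S satisfying P form an additive subgroup containing U; keeping membership in S
    in the conjunction makes it available in the inductive cases. *)
Lemma span_ind (P : B -> Prop) : P 0 -> (forall x, U x -> P x) ->
  (forall x y, S x -> S y -> P x -> P y -> P (x + y)) ->
  (forall x, S x -> P x -> P (- x)) -> forall x, S x -> P x.
Proof.
move=> P0 PU PD PN x Sx; have [S0 SD SN] := span_subgroup.
suff [] : S x /\ P x by [].
apply: (Sx (fun z => S z /\ P z)); split; last first.
  by move=> z Uz; split; [exact: sub_gen_smallest|exact: PU].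
split=> // [a b [? ?] [? ?]|a [? ?]]; split; auto.
Qed.

Lemma span_addJ a x : S x -> S (a + x - a).
Proof.
have [S0 SD SN] := span_subgroup; move: x; apply: span_ind.
- by rewrite badd0r baddNr.
- by move=> x Ux; apply: sub_gen_smallest; exact: UaddJ.
- move=> x y _ _ Sx Sy; have := SD _ _ Sx Sy.
  by rewrite !baddA baddNKr.
- move=> x _ /SN; congr S; apply/esym/bopp_uniq.
  by rewrite !baddA baddNKr baddKr baddNr.
Qed.

Lemma span_lambda a x : S x -> S (lambda a x).
Proof.
have [S0 SD SN] := span_subgroup; move: x; apply: span_ind.
- by rewrite lambda0.
- by move=> x Ux; apply: sub_gen_smallest; exact: Ulambda.
- by move=> x y _ _; rewrite lambdaD; exact: SD.
- by move=> x _; rewrite lambdaN; exact: SN.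
Qed.

(** Circle products and inverses are expressed by additive operations and [lambda], under which S is
    stable. *)
Lemma span_circ : circ_subgroup S.
Proof.
have [S0 SD SN] := span_subgroup; split; first by rewrite brace_one0.
- by move=> a b Sa Sb; rewrite circE; apply: SD => //; exact: span_lambda.
- by move=> a Sa; rewrite invgE; apply: span_lambda; exact: SN.
Qed.

Lemma gen_lambda_span x y : U x -> S y -> lambda x y = y.
Proof.
move=> Ux; move: y; apply: span_ind.
- exact: lambda0.
- by move=> y; exact: UU.
- by move=> y z _ _ ey ez; rewrite lambdaD ey ez.
- by move=> y _ ey; rewrite lambdaN ey.
Qed.

(* If x acts trivially on S, then x + y = x <o> y and - x = x^-1 on S: the
   kernel of the action, a circle subgroup, is also an additive one. *)
Lemma span_lambda_id x y : S x -> S y -> lambda x y = y.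
Proof.
have [S0 SD SN] := span_subgroup.
move=> Sx; move: x Sx y; apply: span_ind.
- by move=> y _; rewrite -brace_one0 lambda1.
- by move=> x Ux y; exact: gen_lambda_span.
- move=> x z Sx Sz ex ez y Sy.
  by rewrite -{1}(ex z Sz) -circE lambdaM ez ?ex.
- move=> x Sx ex y Sy.
  have -> : - x = x^-1%g.
    by rewrite boppE ex //; exact: circ_subgroupV span_circ _ Sx.
  by rewrite -{1}(ex y Sy) -lambdaM mulVg lambda1.
Qed.

(** Circle conjugation need not respect addition, but on S sums are circle products and negatives
    are circle inverses, so induction on the span still applies. *)
Lemma span_circJ a x : S x -> S (a <o> x <o> a^-1%g).
Proof.
have [S1 SM SV] := span_circ; move: x; apply: span_ind.
- by rewrite -brace_one0 mulg1 mulgV.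
- by move=> x Ux; apply: sub_gen_smallest; exact: UcircJ.
- move=> x y Sx Sy JSx JSy; rewrite -{1}(span_lambda_id Sx Sy) -circE.
  by have := SM _ _ JSx JSy; rewrite !mulgA mulgVK.
- move=> x Sx /SV; rewrite boppE (span_lambda_id Sx (SV _ Sx)).
  by rewrite !invgM invgK mulgA.
Qed.

Lemma span_ideal : ideal S.
Proof.
split; [exact: span_subgroup|exact: span_addJ|exact: span_circ|
  exact: span_circJ|].
by move=> a _ [x Sx <-]; exact: span_lambda.
Qed.

End TrivialSpan.

End BraceTheory.

(** * Ideals of the semidirect product supported on the first factor *)

Section SemiDirectIdeal.
Variables (B1 B2 : skewBraceType) (alpha : {multiplicative B2 -> brace_aut B1}).

Definition sd_ideal (S : set B1) : set (semidirect alpha) :=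
  [set u | S u.1 /\ u.2 = 0].

(** Stability under alpha enters because conjugation by [(a, b)] and [lambda] of [(a, b)] act on the
    first coordinate as the corresponding maps for a after [alpha b]. *)
Lemma sd_idealP (S : set B1) : ideal S ->
  (forall b x, S x -> S (alpha b x)) -> ideal (sd_ideal S).
Proof.
move=> [[S0 SD SN] Sn [S1 SM SV] Sc Sl] Sa; split.
- split=> [//|u v [? u2] [? v2]|u [? u2]]; split=> /=; auto.
    by rewrite u2 v2 badd0l.
  by rewrite u2 bopp0.
- move=> a u [? u2]; split=> /=; first exact: Sn.
  by rewrite u2 badd0r baddNr.
- split=> [|u v [? u2] [? v2]|u [? u2]]; split=> /=; auto.
  + by rewrite brace_one0.
  + by rewrite u2 v2 -brace_one0 mulg1.
  + by rewrite u2 -brace_one0 invg1.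
- move=> [a b] [x y] [/= Sx ->]; split=> /=; last first.
    by rewrite -brace_one0 mulg1 mulgV.
  by rewrite -brace_one0 mulg1 -alphaM mulgV alpha1; apply: Sc; exact: Sa.
- move=> [a b] _ [[x y] [/= Sx ->] <-]; split=> /=.
    by apply: (Sl a); exists (alpha b x) => //; exact: Sa.
  by rewrite -brace_one0 mulg1 baddNl brace_one0.
Qed.

End SemiDirectIdeal.

Theorem theorem9 (B1 B2 : skewBraceType)
    (alpha : {multiplicative B2 -> brace_aut B1}) :
  artinian B1 ->
  semiprime (semidirect alpha) ->
  semiprime B1.
Proof.
move=> art spB I idI nI /(star_set_eq0P (ideal0 idI)) I0.
have [M minM MI] := artinian_minimal_ideal art idI nI.
have [idM nM _] := minM.
have M0 x y : M x -> M y -> star x y = 0 by move=> /MI Ix /MI Iy; exact: I0.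
(* U is the union of all translates of M, written as preimages under the [alpha b]. *)
pose U : set B1 := [set x | exists b, M (alpha b x)].
pose S := smallest (@add_subgroup B1) U.
have idMa b : ideal (alpha b @^-1` M) by exact: ideal_preimage.
have UU x y : U x -> U y -> lambda x y = y.
  by move=> [b Mx] [c My]; exact: minimal_preimage_star0 minM M0 Mx My.
have Ul a x : U x -> U (lambda a x).
  by move=> [b Mx]; exists b; apply: (ideal_lambda (idMa b) (a := a)); exists x.
have idS : ideal S.
  apply: span_ideal => // a x [b Mx]; exists b.
  - exact: (ideal_add_normal (idMa b)).
  - exact: (ideal_circ_normal (idMa b)).
have Sa b x : S x -> S (alpha b x).
  have [S0 SD SN] := ideal_add idS.
  move: x; apply: span_ind; rewrite ?brace_aut0 //.
  (* This witness undoes [alpha b] first, so that [alpha b x] is sent to [alpha c x]. *)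
  - move=> x [c Mx]; apply: sub_gen_smallest; exists (c <o> b^-1%g).
    by rewrite -alphaM mulgVK.
  - by move=> x y _ _ Sx Sy; rewrite autD; exact: SD.
  - by move=> x _ Sx; rewrite brace_autN; exact: SN.
have idT := sd_idealP idS Sa.
apply: (spB _ idT) => [eT|].
  (* A non-zero x in M lies in U through the translate by the identity, so [(x, 0)] is a non-zero
     element. *)
  have [x Mx nx] := ideal_neq0 idM nM; apply: nx.
  have : sd_ideal (alpha := alpha) S (x, 0).
    by split=> //=; apply: sub_gen_smallest; exists 1%g; rewrite alpha1.
  by rewrite eT => -[].
apply/(star_set_eq0P (ideal0 idT)) => -[x x2] [y y2] [/= Sx ->] [/= Sy ->].
(* The second coordinates are 0 and [alpha 1%g] is the identity, so the first coordinate is [lambda]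
   in [B1], trivial on S. *)
apply/star_eq0; rewrite /lambda.
congr pair => /=; rewrite -!brace_one0 ?alpha1 ?mulg1.
  exact: (span_lambda_id UU Ul).
by rewrite brace_one0 baddNl.
Qed.
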